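(* For every integer $d\ge 2$ there are positive constants $C,c$ not depending on $n$ and $k$ such that for all integers $k\ge 2$ and $n\ge 1$, \[ |S_{I^d_k}(n)| \ge n^{-Ck}\left(c\,k^{1/(d-1)}\right)^n (n!)^{d-1-1/(d-1)}. \]
   Context: A $d$-dimensional binary matrix of size $n\times\cdots\times n$ is an element of $\{0,1\}^{[n]^d}$. It is a $d$-dimensional $n$-permutation matrix if it has exactly $n$ $1$-entries and any two distinct $1$-entries differ in every coordinate. A $d$-dimensional binary matrix $P$ of size $k_1\times\cdots\times k_d$ is contained in $A$ of size $n_1\times\cdots\times n_d$ if there are increasing injections $f_i:[k_i]\to[n_i]$ with $p_{i_1,\dots,i_d}=1\Rightarrow a_{f_1(i_1),\dots,f_d(i_d)}=1$; otherwise $A$ avoids $P$. $S_P(n)$ is the set of $d$-dimensional $n$-permutation matrices avoiding $P$. $I^d_k$ is the $d$-dimensional $k$-permutation matrix with $1$-entries at $(i,i,\dots,i)$ for $i\in[k]$.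
   Formalization: The bound is stated for n ≥ 2 instead of n ≥ 1: at n = 1 the left side is c·k^{1/(d-1)}, which is unbounded in k, while |S_{I^d_k}(1)| = 1, so the claim fails there for every choice of C and c. *)

(* Defs.v *)
From mathcomp Require Import all_boot.

Set Implicit Arguments.
Unset Strict Implicit.
Unset Printing Implicit Defensive.

(* Coordinates are 0-based: ['I_m] plays the role of [{1, ..., m}]. *)
Definition position (d : nat) (s : 'I_d -> nat) : finType :=
  {dffun forall i : 'I_d, 'I_(s i)}.

Definition binmx (d : nat) (s : 'I_d -> nat) : finType :=
  {ffun position s -> bool}.

Definition cube (d n : nat) : 'I_d -> nat := fun=> n.
Arguments cube : clear implicits.

Definition ones (d : nat) (s : 'I_d -> nat) (A : binmx s) :
    {set position s} :=
  [set x | A x].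

Definition is_permmx (d n : nat) (A : binmx (cube d n)) : bool :=
  (#|ones A| == n) &&
  [forall x in ones A, forall y in ones A,
    (x != y) ==> [forall i, x i != y i]].

Definition increasing (k n : nat) (f : {ffun 'I_k -> 'I_n}) : bool :=
  [forall a : 'I_k, forall b : 'I_k, (a < b) ==> (f a < f b)].

Definition contained (d : nat) (s t : 'I_d -> nat)
    (P : binmx s) (A : binmx t) : bool :=
  [exists f : {dffun forall i : 'I_d, {ffun 'I_(s i) -> 'I_(t i)}},
    [forall i, increasing (f i)] &&
    [forall x : position s,
      P x ==> A [ffun i : 'I_d => (f i (x i) : 'I_(t i))]]].

Definition avoids (d : nat) (s t : 'I_d -> nat)
    (A : binmx t) (P : binmx s) : bool := ~~ contained P A.

Definition avoiders (d : nat) (s : 'I_d -> nat) (P : binmx s) (n : nat) :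
    {set binmx (cube d n)} :=
  [set A | is_permmx A && avoids A P].

Definition idmx (d k : nat) : binmx (cube d k) :=
  [ffun x : position (cube d k) =>
    [exists a : 'I_k, [forall i, x i == a]]].

(* Main.v *)
(** Take a set of cells in a grid with [d * q] blocks per axis, on which the sum
    of the block indices is constant.  Two cells comparable in every coordinate
    are then equal, so an increasing chain stays in one cell.  There are
    [q ^ (d - 1)] cells; put at most [K = k - 1] points in each, where [q] is
    about [(n / K) ^ (1 / (d - 1))].  No chain has [k] points.  The blocks on an
    axis need not have equal length: whatever the lengths, at least
    [n! / (d * q) ^ n] of the orderings of the points along that axis respect
    them, since the other orderings fall into at most [(d * q) ^ n] cosets.
    A matrix arises at most [K ^ n] times, because the cell of each of its
    1-entries can be read off and only the label inside the cell is lost. *)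
Require Import Defs.
From mathcomp Require Import all_boot all_order all_algebra all_fingroup.
From mathcomp Require Import reals exp ring zify.
Set Implicit Arguments.
Unset Strict Implicit.
Unset Printing Implicit Defensive.

(** * Permutations with prescribed levels *)

(** Left multiplication by [t0 * t1^-1] carries the fibre of [t1] under [t |-> h \o t] into that of
    [t0], so none of the at most [#|L| ^ #|T|] fibres is larger than the latter. *)
Lemma card_perm_level (T L : finType) (h : T -> L) (t0 : {perm T}) :
  #|T|`! <= #|L| ^ #|T| *
    #|[set t : {perm T} | [forall p, h (t p) == h (t0 p)]]|.
Proof.
set M := [set t | _].
have fibre (u : {ffun T -> L}) :
    #|[pred t : {perm T} | [ffun p => h (t p)] == u]| <= #|M|.
  have [t1 /eqP t1u|nofib] := pickP [pred t : {perm T} | [ffun p => h (t p)] == u];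
    last by rewrite (eq_card0 nofib).
  rewrite -[X in X <= _](card_image (@mulgI _ (t0 * t1^-1)%g)) subset_leq_card //.
  apply/subsetP => _ /imageP [t /eqP tu ->]; rewrite inE; apply/forallP => p.
  have /ffunP/(_ (t1^-1 (t0 p))%g) : [ffun p => h (t p)] = [ffun p => h (t1 p)].
    by rewrite tu t1u.
  by rewrite !ffunE permKV !permM => ->.
have -> : #|T|`! = #|{perm T}|.
  by rewrite -[RHS]cardsT -cardsT -(card_perm [set: T]); apply: eq_card => t;
     rewrite !inE; apply/subsetP.
rewrite -[leqLHS]sum1_card (partition_big (fun t : {perm T} => [ffun p => h (t p)]) predT) //=.
rewrite -card_ffun -sum_nat_const.
by apply: leq_sum => u _; rewrite sum1_card fibre.
Qed.

Lemma sorting_perm (n : nat) (h : 'I_n -> nat) :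
  exists t : 'S_n, forall p q : 'I_n, p < q -> h (t p) <= h (t q).
Proof.
pose e := relpre h leq.
have /tuple_permP[t def_t] : perm_eq (sort e (ord_tuple n)) (ord_tuple n).
  by rewrite perm_sort.
exists t => p q lt_pq.
have e_tr : transitive e by move=> y x z; apply: leq_trans.
have e_sort : sorted e (sort e (ord_tuple n)).
  by apply: sort_sorted => x y; apply: leq_total.
have nthE (i : 'I_n) : nth p (sort e (ord_tuple n)) i = t i.
  by rewrite def_t -tnth_nth tnth_mktuple tnth_ord_tuple.
have := sorted_ltn_nth e_tr p e_sort; move/(_ p q).
by rewrite !inE !nthE size_sort size_tuple !ltn_ord; apply.
Qed.

(** * Permutation matrices built from levels *)

Section Levels.
(** Label [j] lies in block [h i j] on axis [i] and has number [r j] inside its cell. *)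
Variables (d n K m : nat) (i0 : 'I_d) (h : 'I_d -> 'I_n -> 'I_m) (r : 'I_n -> 'I_K).
Hypothesis h_antichain : forall j j',
  (forall i, h i j <= h i j') -> forall i, h i j = h i j'.
Hypothesis hr_inj : forall j j', (forall i, h i j = h i j') -> r j = r j' -> j = j'.

(** [t i] lists the labels in their order along axis [i]. *)
Definition label_mx (t : 'I_d -> 'S_n) : binmx (cube d n) :=
  [ffun x : position (cube d n) => [exists j, [forall i, t i (x i) == j]]].

Definition label_pos (t : 'I_d -> 'S_n) (j : 'I_n) : position (cube d n) :=
  [ffun i => (t i)^-1%g j].

Lemma label_mxP (t : 'I_d -> 'S_n) (x : position (cube d n)) :
  reflect (exists j, forall i, t i (x i) = j) (label_mx t x).
Proof.
rewrite ffunE; apply: (iffP existsP) => -[j tj]; exists j.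
  by move=> i; apply/eqP/(forallP tj).
by apply/forallP => i; apply/eqP/tj.
Qed.

Lemma label_mx_pos (t : 'I_d -> 'S_n) (j : 'I_n) : label_mx t (label_pos t j).
Proof. by apply/label_mxP; exists j => i; rewrite ffunE permKV. Qed.

Lemma label_mx_perm (t : 'I_d -> 'S_n) : is_permmx (label_mx t).
Proof.
apply/andP; split.
  have -> : ones (label_mx t) = [set label_pos t j | j in 'I_n].
    apply/setP => x; rewrite inE; apply/label_mxP/imsetP => [[j tj]|[j _ ->]].
      by exists j => //; apply/ffunP => i; rewrite ffunE -(tj i) permK.
    by exists j => i; rewrite ffunE permKV.
  rewrite card_imset ?card_ord // => j j' /ffunP/(_ i0).
  by rewrite !ffunE => /perm_inj.
apply/forall_inP => x; rewrite inE => /label_mxP[j tx].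
apply/forall_inP => y; rewrite inE => /label_mxP[j' ty].
apply/implyP => neq_xy; apply/forallP => i.
apply: contraNneq neq_xy => eq_xy; apply/eqP/ffunP => i'.
by apply: (@perm_inj _ (t i')); rewrite tx ty -(tx i) -(ty i) eq_xy.
Qed.

(** Along a chain the levels weakly increase on every axis, so [h_antichain] makes them constant;
    [r] would then separate [K.+1] labels with only [K] values. *)
Lemma label_mx_avoids (t : 'I_d -> 'S_n) :
  (forall i (p q : 'I_n), p < q -> h i (t i p) <= h i (t i q)) ->
  avoids (label_mx t) (idmx d K.+1).
Proof.
move=> t_mono; apply/negP => /existsP[f /andP[/forallP f_inc /forallP f_emb]].
pose J (a : 'I_K.+1) : 'I_n := t i0 (f i0 a).
have tfE i (a : 'I_K.+1) : t i (f i a) = J a.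
  have /implyP/(_ _)/label_mxP := f_emb [ffun i => a : 'I_(cube d K.+1 i)].
  have diag : idmx d K.+1 [ffun i => a : 'I_(cube d K.+1 i)].
    by rewrite ffunE; apply/existsP; exists a; apply/forallP => i'; rewrite ffunE.
  by case/(_ diag) => j fj; rewrite /J; move: (fj i) (fj i0); rewrite !ffunE => -> ->.
have f_lt i (a b : 'I_K.+1) : a < b -> f i a < f i b.
  by move=> lt_ab; have /forallP/(_ a)/forallP/(_ b)/implyP/(_ lt_ab) := f_inc i.
have hJ_lt (a b : 'I_K.+1) i : a < b -> h i (J a) = h i (J b).
  move=> lt_ab; apply: h_antichain => {}i; rewrite -!(tfE i); apply: t_mono.
  exact: f_lt.
have J_inj : injective J.
  move=> a b /perm_inj eq_f; apply: val_inj.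
  by case: (ltngtP a b) => // /(f_lt i0); rewrite eq_f ltnn.
have rJ_inj : injective (r \o J).
  move=> a b /= eq_r; apply: J_inj; apply: hr_inj eq_r => i.
  by case: (ltngtP a b) => [/hJ_lt|/hJ_lt|/val_inj->].
by have := leq_card _ rJ_inj; rewrite !card_ord ltnn.
Qed.

Lemma card_avoiders_levels :
  n`! ^ d <= (m ^ n) ^ d * K ^ n * #|avoiders (idmx d K.+1) n|.
Proof.
have [t0 t0_mono] := fin_all_exists (fun i => sorting_perm (h i)).
pose M i := [set t : 'S_n | [forall p, h i (t p) == h i (t0 i p)]].
have card_M i : n`! <= m ^ n * #|M i|.
  by have := card_perm_level (h i) (t0 i); rewrite !card_ord.
pose F : {set {ffun 'I_d -> 'S_n}} := [set t in family M].
have M_level t i p : t \in F -> h i (t i p) = h i (t0 i p).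
  by rewrite inE => /familyP/(_ i); rewrite inE => /forallP/(_ p)/eqP.
have card_F : n`! ^ d <= (m ^ n) ^ d * #|F|.
  rewrite cardsE card_family foldrE big_image /=.
    rewrite -{1 2}(card_ord d) -!prod_nat_const -big_split /=.
  by apply: leq_prod.
apply: leq_trans card_F _; rewrite -mulnA leq_mul2l; apply/orP; right.
(* [M] fixes the levels at each position, so the entry through [p] on axis [i0]
   determines the cell of its label; [r] then determines the label. *)
pose code (t : {ffun 'I_d -> 'S_n}) := (label_mx t, [ffun p => r (t i0 p)]).
have code_inj : {in F &, injective code}.
  move=> t t' Ft Ft' [eq_mx /ffunP eq_r].
  have fixed j i : t' i ((t i)^-1%g j) = j.
    have := label_mx_pos t j; rewrite eq_mx => /label_mxP[j' t'j].
    have eq_j : j' = j.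
      apply: hr_inj => [i'|].
        by rewrite -(t'j i') ffunE M_level // -(M_level t) // permKV.
      by have := eq_r ((t i0)^-1%g j); rewrite !ffunE permKV -(t'j i0) ffunE.
    by have := t'j i; rewrite ffunE eq_j.
  by apply/ffunP => i; apply/permP => p; rewrite -[LHS](fixed _ i) permK.
rewrite -(card_in_imset code_inj).
have := subset_leq_card (_ : code @: F \subset
  setX (avoiders (idmx d K.+1) n) [set: {ffun 'I_n -> 'I_K}]).
rewrite cardsX cardsT card_ffun !card_ord [_ * K ^ n]mulnC; apply.
apply/subsetP => _ /imsetP[t Ft ->]; rewrite !inE andbT label_mx_perm /=.
apply: label_mx_avoids => i p q lt_pq.
by rewrite !M_level //; apply: t0_mono.
Qed.
End Levels.

(** * The grid of cells with constant level sum *)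

Lemma card_avoiders_grid (e n K q : nat) : 0 < q -> n <= q ^ e * K ->
  n`! ^ e.+1 <=
    ((e.+1 * q) ^ n) ^ e.+1 * K ^ n * #|avoiders (idmx e.+1 K.+1) n|.
Proof.
move=> q_gt0 le_n.
have [f f_inj] : exists f : 'I_n -> {ffun 'I_e -> 'I_q} * 'I_K, injective f.
  have le_card : n <= #|{: {ffun 'I_e -> 'I_q} * 'I_K}|.
    by rewrite card_prod card_ffun !card_ord.
  exists (fun j => enum_val (widen_ord le_card j)) => j j' /enum_val_inj/(congr1 val)/= eq_j.
  exact: ord_inj.
(* The level on axis 0 makes the sum of all levels equal to [e * q]. *)
pose S j := \sum_i ((f j).1 i : nat).
pose hn (o : option 'I_e) (j : 'I_n) := if o is Some i then (f j).1 i : nat else e * q - S j.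
have S_le j : S j <= e * q.
  rewrite -[X in X * q]card_ord -sum_nat_const; apply: leq_sum => i _; exact: ltnW.
(* Levels on axis 0 can reach [e * q], hence [e.+1 * q] blocks. *)
have hn_lt o j : hn o j < e.+1 * q.
  case: o => [i|] /=; first by rewrite (leq_trans (ltn_ord _)) // leq_pmull.
  by rewrite mulSn -add1n leq_add // leq_subr.
pose h (i : 'I_e.+1) j := Ordinal (hn_lt (unlift ord0 i) j).
have hS j (i : 'I_e) : h (lift ord0 i) j = (f j).1 i :> nat by rewrite /= liftK.
have h0 j : h ord0 j = e * q - S j :> nat by rewrite /= unlift_none.
apply: (@card_avoiders_levels _ _ _ _ ord0 h (fun j => (f j).2)) => j j'.
  move=> le_h.
  have le_f i : (f j).1 i <= (f j').1 i by rewrite -!hS.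
  (* [le_f] gives one inequality between the sums, and axis 0, where the sum is subtracted, gives
     the other. *)
  have eq_S : S j = S j'.
    apply/eqP; rewrite eqn_leq leq_sum //=.
    by have := le_h ord0; rewrite !h0 leq_sub2lE.
  have eq_f i : (f j).1 i = (f j').1 i :> nat.
    have [_] := leqif_sum (fun i (_ : true) => leqif_eq (le_f i)).
    by rewrite -/(S j) -/(S j') eq_S eqxx => /esym/forallP/(_ i)/implyP/(_ isT)/eqP.
  move=> i; apply: ord_inj; case: (unliftP ord0 i) => [i'|] ->; last by rewrite !h0 eq_S.
  by rewrite !hS eq_f.
move=> eq_h eq_r; apply: f_inj; apply: injective_projections eq_r.
by apply/ffunP => i; apply: ord_inj; rewrite -!hS eq_h.
Qed.

(** * Numerical estimates *)

Lemma bin_leq_exp2 n m : 'C(n, m) <= 2 ^ n.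
Proof.
elim: n m => [|n IHn] [|m] //; first by rewrite bin0 expn_gt0.
by rewrite binS expnS mul2n -addnn leq_add.
Qed.

Lemma exp_leq_fact m n : m ^ n <= 2 ^ (m + n) * n`!.
Proof.
have : m ^ n <= (m + n) ^_ n.
  elim: n => [|n IHn] //; rewrite addnS ffactSS expnS leq_mul //.
  by rewrite -addnS leq_addr.
by move/leq_trans; apply; rewrite -bin_ffact leq_mul2r bin_leq_exp2 orbT.
Qed.

(** Take the least [q]. If [q >= 2], then [q <= 2 * (q - 1)] and [(q - 1) ^ e * K < n] by
    minimality; the summand [K] covers [q = 1]. *)
Lemma grid_side (e n K : nat) : 0 < e -> 0 < K ->
  exists2 q, 0 < q & n <= q ^ e * K <= 2 ^ e * (n + K).
Proof.
move=> e_gt0 K_gt0.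
have exq : exists q, (0 < q) && (n <= q ^ e * K).
  exists n.+1; rewrite /= (leq_trans (leqnSn n)) //.
  by rewrite -[X in X <= _]muln1 leq_mul // -[X in X <= _]expn1 leq_pexp2l.
case: (ex_minnP exq) => q /andP[q_gt0 n_le] q_min.
exists q; rewrite // n_le /=.
case: q q_gt0 n_le q_min => // -[|q] _ n_le q_min.
  by rewrite exp1n leq_mul ?expn_gt0 // leq_addl.
have lt_n : q.+1 ^ e * K < n.
  by rewrite ltnNge; apply/negP => le_n; have := q_min q.+1 le_n; rewrite ltnn.
apply: (@leq_trans ((2 * q.+1) ^ e * K)).
  by rewrite leq_mul // leq_exp2r // mul2n -addnn addSn addnS !ltnS leq_addl.
by rewrite expnMn -mulnA leq_mul // (leq_trans (ltnW lt_n)) ?leq_addr.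
Qed.

(** Taking the [e]-th power of the target, with [e = d - 1], clears the roots:
    [e * (e - 1 / e) = e.+1 * e.-1]. *)
Lemma card_avoiders_exp (e n K : nat) : 0 < e -> 0 < K ->
  K ^ n * n`! ^ (e.+1 * e.-1) <=
    #|avoiders (idmx e.+1 K.+1) n| ^ e *
      ((2 * e.+1) ^ (e.+1 * e * n) * 2 ^ ((2 * n + K) * e.+1)).
Proof.
move=> e_gt0 K_gt0; have [q q_gt0 /andP[n_le q_le]] := grid_side n e_gt0 K_gt0.
set s := #|_|; set d := e.+1.
have le1 := card_avoiders_grid q_gt0 n_le; rewrite -/s -/d in le1.
rewrite -(leq_pmul2l (_ : 0 < n`! ^ d)) ?expn_gt0 ?fact_gt0 //.
rewrite mulnCA -expnD -mulnS prednK // [n`! ^ (d * e)]expnM.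
apply: (@leq_trans (K ^ n * (((d * q) ^ n) ^ d * K ^ n * s) ^ e)).
  by rewrite leq_mul // leq_exp2r.
have -> : K ^ n * (((d * q) ^ n) ^ d * K ^ n * s) ^ e =
    s ^ e * (d ^ (d * e * n) * (q ^ e * K) ^ (n * d)).
  rewrite !expnMn -!expnM.
  have -> : n * (d * e) = d * e * n by ring.
  have -> : e * (n * d) = d * e * n by ring.
  have -> : n * d = n + n * e by rewrite mulnS.
  rewrite expnD.
  by move: (d ^ _) (q ^ _) (K ^ n) (K ^ (n * e)) (s ^ e) => *; ring.
rewrite [leqRHS]mulnCA leq_mul2l; apply/orP; right.
have -> : n`! ^ d * ((2 * d) ^ (d * e * n) * 2 ^ ((2 * n + K) * d)) =
    d ^ (d * e * n) * (2 ^ (d * e * n) * (2 ^ (2 * n + K) * n`!) ^ d).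
  rewrite !expnMn -expnM.
  by move: (d ^ _) (2 ^ _) (2 ^ _) (_ ^ d) => *; ring.
rewrite leq_mul2l; apply/orP; right.
apply: (@leq_trans ((2 ^ e * (n + K)) ^ (n * d))).
  by case: (n * d) => // l; rewrite leq_exp2r.
rewrite expnMn -expnM [(n + K) ^ _]expnM.
have -> : e * (n * d) = d * e * n by ring.
rewrite leq_mul2l leq_exp2r //; apply/orP; right.
have -> : 2 * n + K = n + K + n by ring.
exact: exp_leq_fact.
Qed.

(** A factor [2 ^ n] replaces [K] by [k = K.+1 <= 2 * K]; since [2 <= n], the powers of 2 with
    exponent of order [k] go into a power of [n]. *)
Lemma card_avoiders_nat (e n k : nat) : 0 < e -> 1 < k -> 1 < n ->
  k ^ n * n`! ^ (e.+1 * e.-1) <=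
    #|avoiders (idmx e.+1 k) n| ^ e *
      (n ^ (2 * k * e) * (2 ^ 5 * (2 * e.+1) ^ e.+1) ^ (n * e)).
Proof.
case: k => // K e_gt0 K_gt0 n_gt1; have K1 : 0 < K by [].
apply: (@leq_trans (2 ^ n * (K ^ n * n`! ^ (e.+1 * e.-1)))).
  rewrite mulnA leq_mul // -expnMn; case: n {n_gt1} => // n.
  by rewrite leq_exp2r //; lia.
apply: leq_trans (leq_mul (leqnn _) (card_avoiders_exp n e_gt0 K1)) _.
rewrite mulnCA leq_mul2l; apply/orP; right.
rewrite mulnCA [(2 ^ 5 * _) ^ _]expnMn [leqRHS]mulnA [leqRHS]mulnC.
rewrite -!expnM -mulnA [n * e]mulnC leq_mul //.
(* The 5 comes from [n + 2 * n * e.+1 <= 5 * (e * n)], and [K * e.+1 <= 2 * K.+1 * e]; both use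
   [0 < e]. *)
apply: (@leq_trans (2 ^ (2 * K.+1 * e) * 2 ^ (5 * (e * n)))).
  by rewrite -!expnD leq_exp2l //; nia.
by rewrite leq_mul // leq_exp2r // muln_gt0.
Qed.

(** * The bound with real exponents *)

Import Order.TTheory GRing.Theory Num.Theory.
Local Open Scope ring_scope.

(* The case n = 1 is excluded: there the left-hand side is c * k ^ (1/(d-1)),
   unbounded in k, while the cardinal is 1. *)
Theorem theorem7p5 (R : realType) (d : nat) (hd : (2 <= d)%N) :
  exists C c : R, [/\ 0 < C, 0 < c &
    forall k n : nat, (2 <= k)%N -> (2 <= n)%N ->
      n%:R `^ (- (C * k%:R))
        * (c * k%:R `^ (1 / (d%:R - 1))) ^+ n
        * (n`!)%:R `^ (d%:R - 1 - 1 / (d%:R - 1))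
      <= #|avoiders (idmx d k) n|%:R].
Proof.
case: d hd => [|e] // e_gt0; have {}e_gt0 : (0 < e)%N by [].
pose b := (2 ^ 5 * (2 * e.+1) ^ e.+1)%N.
have b_gt0 : (0 < b)%N by rewrite muln_gt0 !expn_gt0.
have e_neq0 : e%:R != 0 :> R by rewrite pnatr_eq0 -lt0n.
(* These are read off from the factors [n ^ (2 * k * e)] and [b ^ (n * e)] of [card_avoiders_nat] by
   taking [e]-th roots. *)
exists 2, b%:R^-1; split; rewrite ?invr_gt0 ?ltr0n // => k n k_gt1 n_gt1.
have -> : e.+1%:R - 1 = e%:R :> R by rewrite -natr1 addrK.
have c_ge0 : 0 <= b%:R^-1 :> R by rewrite invr_ge0.
have powE (x y : R) : 0 <= x -> (x `^ y) ^+ e = x `^ (y * e%:R).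
  by move=> x_ge0; rewrite powRrM powR_mulrn ?powR_ge0.
rewrite -(@ler_pXn2r _ e) ?nnegrE ?mulr_ge0 ?exprn_ge0 ?powR_ge0 ?mulr_ge0 ?powR_ge0 //.
rewrite !exprMn -exprM [(n * e)%N]mulnC [_ ^+ n ^+ e]exprAC !powE //.
rewrite mulrBl !divfK // powRr1 //.
have -> : e%:R * e%:R - 1 = (e.+1 * e.-1)%:R :> R.
  by apply/eqP; rewrite subr_eq -natrM natr1 eqr_nat; apply/eqP; nia.
rewrite mulNr powRN -!natrM !powR_mulrn // exprVn -!natrX.
rewrite mulrA -invfM -mulrA mulrC -!natrM ler_pdivrMr; last first.
  by rewrite ltr0n muln_gt0 !expn_gt0 b_gt0 ltnW.
by rewrite -natrM ler_nat [(e * n)%N]mulnC card_avoiders_nat.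
Qed.
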